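(* Let $\mathcal{A}\in\mathbb{C}^{n\times n\times p}$ be such that $(\mathcal{A}^T*\mathcal{A})^{-1/2}$ is defined. Then the function $\mathcal{M}\mapsto\|\mathcal{M}\|_\star:=\mathrm{trace}_{(1)}\big(\sqrt{\mathcal{M}^T*\mathcal{M}}\big)$ is (Fréchet) differentiable at $\mathcal{A}$ and $$\nabla_{\mathcal{A}}\|\mathcal{A}\|_\star=\mathcal{A}*(\mathcal{A}^T*\mathcal{A})^{-1/2},$$ where the gradient $\nabla_{\mathcal{A}}\|\mathcal{A}\|_\star\in\mathbb{C}^{n\times n\times p}$ is the tensor characterized by $L_{\|\cdot\|_\star}(\mathcal{A},\mathcal{C})=\mathrm{trace}_{(1)}\big((\nabla_{\mathcal{A}}\|\mathcal{A}\|_\star)^T*\mathcal{C}\big)$ for all $\mathcal{C}\in\mathbb{C}^{n\times n\times p}$.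
   Context: For a tensor $\mathcal{A}\in\mathbb{C}^{n\times m\times p}$ with frontal slices $A^{(1)},\dots,A^{(p)}\in\mathbb{C}^{n\times m}$, $\mathrm{unfold}(\mathcal{A})\in\mathbb{C}^{np\times m}$ is the block column with blocks $A^{(1)},\dots,A^{(p)}$, and $\mathrm{fold}$ is its inverse. $\mathrm{bcirc}(\mathcal{A})$ is the block circulant matrix whose first block column is $\mathrm{unfold}(\mathcal{A})$, i.e. its $(r,s)$ block is $A^{(((r-s)\bmod p)+1)}$. The t-product is $\mathcal{A}*\mathcal{B}:=\mathrm{fold}(\mathrm{bcirc}(\mathcal{A})\,\mathrm{unfold}(\mathcal{B}))$. The transpose $\mathcal{A}^T$ is obtained by transposing each frontal slice and then reversing the order of the 2nd through $p$th transposed slices (so $\mathrm{bcirc}(\mathcal{A}^T)=\mathrm{bcirc}(\mathcal{A})^T$). $\mathrm{trace}_{(1)}(\mathcal{M})$ is the trace of the first frontal slice of $\mathcal{M}$. For a scalar function $f$, the tensor t-function is $f(\mathcal{M}):=\mathrm{fold}(f(\mathrm{bcirc}(\mathcal{M}))\boldsymbol{E}_1)$ with $\boldsymbol{E}_1=\boldsymbol{e}_1\otimes I_n\in\mathbb{C}^{np\times n}$ and $f(\mathrm{bcirc}(\mathcal{M}))$ the usual (primary) matrix function; $\sqrt{\mathcal{M}}$ and $\mathcal{M}^{-1/2}$ are the t-functions for the principal branches of $z^{1/2}$ and $z^{-1/2}$. ''$(\mathcal{A}^T*\mathcal{A})^{-1/2}$ is defined'' means that $\mathrm{bcirc}(\mathcal{A}^T*\mathcal{A})$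 has no eigenvalue in $(-\infty,0]$. $L_g(\mathcal{A},\cdot)$ denotes the Fréchet derivative of a function $g$ at $\mathcal{A}$: the linear map with $g(\mathcal{A}+\mathcal{C})-g(\mathcal{A})=L_g(\mathcal{A},\mathcal{C})+o(\|\mathcal{C}\|)$, $\|\cdot\|$ being the Frobenius norm. For real $\mathcal{A}$, $\|\mathcal{A}\|_\star$ is the tensor nuclear norm. *)

(* Defs.v *)
From HB Require Import structures.
From mathcomp Require Import all_boot all_order all_algebra.
From mathcomp Require Import complex.
From mathcomp Require Import all_classical all_reals all_analysis.

Set Implicit Arguments.
Unset Strict Implicit.
Unset Printing Implicit Defensive.

Import Order.TTheory GRing.Theory Num.Theory.
Import numFieldNormedType.Exports.

Local Open Scope classical_set_scope.
Local Open Scope ring_scope.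
Local Open Scope complex_scope.

Section MatrixFunction.
Variable K : numClosedFieldType.
Implicit Types f : K -> K^o.

(* [mup a (mxminpoly M)] is the index of the eigenvalue [a], i.e. the size of
   its largest Jordan block.  The derivatives of [f] are complex derivatives,
   and they are required to exist, since [derive1n] is a total function; [f] need
   not be differentiable at an eigenvalue of index 1. *)
Definition interpolates_on_spectrum f N (M : 'M[K]_N.+1) (q : {poly K}) :=
  forall a : K, eigenvalue M a ->
    (forall k, (k.+1 < mup a (mxminpoly M))%N ->
       \forall z \near a, derivable (derive1n k f) z 1) /\
    (forall k, (k < mup a (mxminpoly M))%N ->
       (derivn k q).[a] = derive1n k f a).

(* [mxminpoly] and [horner_mx] only exist for non-empty matrices. *)
Definition is_matfun f N : 'M[K]_N -> set 'M[K]_N :=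
  match N return 'M[K]_N -> set 'M[K]_N with
  | 0%N => fun _ => setT
  | N'.+1 => fun M => [set X | exists2 q : {poly K},
      interpolates_on_spectrum f M q & X = horner_mx M q]
  end.

(* The primary matrix function (Hermite interpolation on the spectrum); it is
   the junk value 0 when [f] is not defined on the spectrum of [M]. *)
Definition matfun f N (M : 'M[K]_N) : 'M[K]_N := xget 0 (is_matfun f M).

End MatrixFunction.

(* The frontal slice A^(k+1) of [A : tensor K n m p] is [A k]. *)
Notation tensor K n m p := {ffun 'I_p -> 'M[K]_(n, m)}.

Section Tensor.
Variable K : numClosedFieldType.
(* The third dimension is p.+1, so that ['I_p.+1] is Z/(p+1)Z: the subtraction
   and the opposite of slice indices below are modular. *)
Variable p : nat.

Definition unfold n m (A : tensor K n m p.+1) : 'M[K]_(\sum_(r < p.+1) n, m) :=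
  \mxcol_(r < p.+1) A r.

Definition fold n m (B : 'M[K]_(\sum_(r < p.+1) n, m)) : tensor K n m p.+1 :=
  [ffun r : 'I_p.+1 => @submxcol K p.+1 (fun=> n) m B r].

Definition bcirc n m (A : tensor K n m p.+1) :
    'M[K]_(\sum_(r < p.+1) n, \sum_(s < p.+1) m) :=
  \mxblock_(r < p.+1, s < p.+1) A (r - s).

Definition tprod n m l (A : tensor K n m p.+1) (B : tensor K m l p.+1) :
    tensor K n l p.+1 :=
  fold (bcirc A *m unfold B).

Definition ttr n m (A : tensor K n m p.+1) : tensor K m n p.+1 :=
  [ffun k : 'I_p.+1 => (A (- k))^T].

Definition trace1 n (A : tensor K n n p.+1) : K := \tr (A 0).

Definition E1 n : 'M[K]_(\sum_(r < p.+1) n, n) :=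
  \mxcol_(r < p.+1) ((r == 0)%:R%:M).

Definition tfun n (f : K -> K^o) (A : tensor K n n p.+1) : tensor K n n p.+1 :=
  fold (matfun f (bcirc A) *m E1 n).

Definition frobenius n m (A : tensor K n m p.+1) : K :=
  sqrtC (\sum_k \sum_i \sum_j `|A k i j| ^+ 2).

(* The linear map is K-linear; [0 < e] forces e to be real. *)
Definition is_frechet n m (g : tensor K n m p.+1 -> K) (A : tensor K n m p.+1)
    (L : tensor K n m p.+1 -> K) :=
  scalar L /\
  forall e : K, 0 < e -> exists2 d : K, 0 < d &
    forall C : tensor K n m p.+1, frobenius C < d ->
      `|g (A + C) - g A - L C| <= e * frobenius C.

Definition frechet_differentiable n m (g : tensor K n m p.+1 -> K)
    (A : tensor K n m p.+1) :=
  exists L, is_frechet g A L.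

Definition is_gradient n (g : tensor K n n p.+1 -> K)
    (A G : tensor K n n p.+1) :=
  exists2 L, is_frechet g A L & forall C, L C = trace1 (tprod (ttr G) C).

End Tensor.

Section NuclearNorm.
Variable R : realType.

(* [sqrtc] is the principal square root (nonnegative real part), unlike
   [sqrtC], whose values have nonnegative imaginary part. *)
Definition psqrt (z : R[i]) : R[i] := sqrtc z.

(* The value at 0 is the junk value 0. *)
Definition pisqrt (z : R[i]) : R[i] := (sqrtc z)^-1.

Definition tsqrt p n (A : tensor R[i] n n p.+1) : tensor R[i] n n p.+1 :=
  @tfun R[i] p n psqrt A.

Definition tisqrt p n (A : tensor R[i] n n p.+1) : tensor R[i] n n p.+1 :=
  @tfun R[i] p n pisqrt A.

(* In the partial order of R[i], [a <= 0] means that [a] is real and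
   nonpositive. *)
Definition tisqrt_defined p n (A : tensor R[i] n n p.+1) :=
  forall a : R[i], eigenvalue (bcirc A) a -> ~~ (a <= 0).

Definition nuclear_norm p n (A : tensor R[i] n n p.+1) : R[i] :=
  trace1 (tsqrt (tprod (ttr A) A)).

End NuclearNorm.

(* Main.v *)
Require Import Defs.
From mathcomp Require Import all_boot all_order all_algebra.
From mathcomp Require Import ring.
From mathcomp Require Import complex.
From mathcomp Require Import all_classical all_reals all_analysis.

(** The map [bcirc] turns the t-product into the matrix product and the tensor
    transpose into the matrix transpose, and t-functions commute with it, since
    a primary function of a block circulant matrix commutes with the block
    shifts and is therefore block circulant.  As [\tr (bcirc M)] is [p.+1] times
    [trace1 M], the theorem is about the function B |-> tr sqrt(B^T B) of a
    complex matrix B: at H, its differential must be tr ((B Y)^T H), where Y is the inverse square root of B^T B.  The transpose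
    is not conjugated, so B^T B need not be diagonalizable.

    Let X = sqrt(B^T B), and let X + D be the square root of
    (B + H)^T (B + H) = B^T B + E.  Subtracting the squares gives
    X D + D X = E - D^2.  Multiplying by Y = X^-1 and taking the trace, one
    finds 2 tr D = tr (Y E) - tr (Y D^2), and the part of tr (Y E) that is linear
    in H is 2 tr ((B Y)^T H), because Y is symmetric
    ([trace_root_expansion]).  What remains is D = O(H).  The Sylvester map
    D |-> X D + D X is injective, since the eigenvalues of X have positive real
    part ([sylvester_inj]); hence |D| <= c (|E| + |D|^2), and the square is
    absorbed as soon as D tends to 0.

    So the principal square root has to be continuous ([matfun_root_cvg]).  If
    p is the product of the 'X - sqrt a over the eigenvalues a of M, then p
    annihilates sqrt M.  Splitting p into its even and odd parts gives
    P(M) + Q(M) sqrt M = 0, that is, sqrt M = - P(M) Q(M)^-1; the matrix Q(M) is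
    invertible because sqrt M and - sqrt M have no common eigenvalue
    ([root_eq_even_odd]).  The coefficients of p depend continuously on M,
    because the roots of a polynomial do ([roots_cvg]).

    The definition of a primary matrix function by interpolation enters through
    one observation: f(z) = z^al satisfies the Euler equation z f' = al f, so
    every polynomial q interpolating f satisfies it modulo ('X - a)^(m - 1) at an
    eigenvalue a of index m, and a polynomial that vanishes at a nonzero a and
    solves an Euler equation to that order is divisible by ('X - a)^m
    ([dvd_XsubCX_euler]).  Applied to q^2 - 'X and to q r - 1, where q and r
    interpolate z^(1/2) and z^(-1/2), this gives sqrt M ^ 2 = M and
    sqrt M * M^(-1/2) = 1 ([matfun_root_spec]). *)

Set Implicit Arguments.
Unset Strict Implicit.
Unset Printing Implicit Defensive.

Import Order.TTheory GRing.Theory Num.Theory.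
Import numFieldNormedType.Exports.

Local Open Scope classical_set_scope.
Local Open Scope ring_scope.

(** * The principal square root off the cut *)

Section DerivativesOfPowers.
Variables (K : numFieldType) (U : K -> Prop) (f w : K -> K) (al : K).
Hypothesis U_open : forall z, U z -> \forall y \near z, U y.
Hypothesis df : forall z, U z -> is_derive z 1 f (al * f z * w z ^+ 2).
Hypothesis dw : forall z, U z -> is_derive z 1 w (- 2^-1 * w z ^+ 3).

(** For f = z^al and w = z^(-1/2): the hypotheses are the derivatives of these
    powers, and they determine all the higher derivatives of f. *)
Lemma derive1n_power k z : U z ->
  derive1n k f z = \prod_(i < k) (al - i%:R) * f z * w z ^+ (2 * k) /\
  derivable (derive1n k f) z 1.
Proof.
elim: k z => [|k IH] z Uz.
  by rewrite big_ord0 mul1r mulr1; split => //; have [] := df Uz.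
have D x : U x -> is_derive x 1 (derive1n k f)
   (\prod_(i < k.+1) (al - i%:R) * f x * w x ^+ (2 * k.+1)).
  move=> Ux; pose c := \prod_(i < k) (al - i%:R).
  have := is_deriveM (df Ux) (is_deriveX (2 * k) (dw Ux)).
  move=> /(is_deriveZ c) h.
  have : \near x, (c \*: (f * w ^+ (2 * k))) x = derive1n k f x.
    near=> y; have Uy : U y by near: y; exact: U_open.
    by rewrite (IH _ Uy).1 -[RHS]mulrA /= !fctE.
  move=> /near_eq_is_derive /(_ h) h1; apply: (is_derive_eq h1).
  rewrite big_ord_recr/= -/c /GRing.scale/= fctE.
  case: (k) => [|m].
    by rewrite muln0 muln1 /= !mul0r mulr0 add0r expr0 mul1r subr0 !mulrA.
  rewrite natrM; have -> : (2 * m.+1)%N = (2 * m).+2 by rewrite mulnS.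
  have -> : (2 * m.+2)%N = (2 * m).+4 by rewrite !mulnS.
  move: (2 * m)%N (m.+1%:R : K) => j n; rewrite /= !exprS.
  clear h h1; move: (c) (f x) (w x) (w x ^+ j) => {}c fx wx wj.
  by rewrite expr0; field; exact: isT.
have d := D _ Uz.
split; first by rewrite derive1nS derive1E derive_val.
pose c := \prod_(i < k.+1) (al - i%:R).
suff : {near z, c \*: (f * w ^+ (2 * k.+1)) =1 derive1n k.+1 f}.
  move=> /near_eq_derivable; apply.
  by have [] := is_deriveZ c (is_deriveM (df Uz) (is_deriveX (2 * k.+1) (dw Uz))).
near=> y; have Uy : U y by near: y; exact: U_open.
by rewrite derive1nS derive1E; have [_ ->] := D _ Uy; rewrite -[RHS]mulrA /= !fctE.
Unshelve. all: by end_near. Qed.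

End DerivativesOfPowers.

Section PrincipalRoot.
Variable K : numClosedFieldType.

(** For negative z both square roots meet the second condition, so s is not unique
    there; it is unique where ['Re (s z)] is positive, the domain used below. *)
Definition principal_root (s : K -> K) :=
  (forall z, s z ^+ 2 = z) /\ (forall z, 0 <= 'Re (s z)).

Variable s : K -> K.
Hypothesis sP : principal_root s.

(** A root with zero real part is purely imaginary, so its square is at most 0. *)
Lemma principal_root_slit z : ~~ (z <= 0) -> 0 < 'Re (s z).
Proof.
case: sP => sK s_ge0; apply: contraNT; rewrite real_ltNge ?Creal_Re// negbK => h.
have re0 : 'Re (s z) = 0 by apply/eqP; rewrite eq_le h s_ge0.
rewrite -(sK z) [s z]Crect re0 add0r exprMn sqrCi mulN1r oppr_le0.
by rewrite -realEsqr Creal_Im.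
Qed.

Lemma Re_le_norm (z : K) : 'Re z <= `|z|.
Proof.
apply: le_trans (leif_normC_Re_Creal z).1.
by apply: real_ler_norm; rewrite Creal_Re.
Qed.

Lemma Re_gt0_neq0 (z : K) : 0 < 'Re z -> z != 0.
Proof. by apply: contraTneq => ->; rewrite raddf0 ltxx. Qed.

(** [z0 - z] is the product of the difference and of the sum of the roots, and the
    real part of the sum is at least ['Re (s z0)]. *)
Lemma principal_root_dist z0 z :
  `|s z0 - s z| * 'Re (s z0) <= `|z0 - z|.
Proof.
case: sP => sK s_ge0.
have -> : z0 - z = (s z0 - s z) * (s z0 + s z) by rewrite -subr_sqr !sK.
rewrite normrM ler_wpM2l//; apply: le_trans (Re_le_norm _).
by rewrite raddfD/= lerDl.
Qed.

Lemma principal_root_continuous z0 : 0 < 'Re (s z0) ->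
  s z @[z --> z0] --> s z0.
Proof.
move=> z0_gt0; apply/(@cvgrPdist_lt K K _ _ (nbhs_filter z0)) => e e0.
near=> z; rewrite -(ltr_pM2r z0_gt0).
apply: le_lt_trans (principal_root_dist _ _) _.
near: z; apply/nbhs_normP; exists (e * 'Re (s z0)) => //=.
exact: mulr_gt0.
Unshelve. all: by end_near. Qed.

Lemma near_slit z0 : 0 < 'Re (s z0) -> \forall z \near z0, 0 < 'Re (s z).
Proof.
move=> z0_gt0; near=> z.
have : `|s z0 - s z| < 'Re (s z0).
  near: z.
  move/(@cvgrPdist_lt K K _ _ (nbhs_filter z0)): (principal_root_continuous z0_gt0).
  exact.
move=> /(le_lt_trans (Re_le_norm _)); rewrite raddfB/=.
by rewrite ltrBlDr ltrDl.
Unshelve. all: by end_near. Qed.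

Lemma is_derive_root z0 : 0 < 'Re (s z0) ->
  is_derive z0 1 (s : K -> K^o) (2^-1 * (s z0)^-1).
Proof.
move=> z0_gt0; have [sK s_ge0] := sP.
suff h : h^-1 *: (s (h *: (1 : K) + z0) - s z0) @[h --> (0 : K)^'] -->
    2^-1 * (s z0)^-1.
  by apply: DeriveDef; [apply/cvg_ex; eexists; exact: h | exact: cvg_lim h].
have h0 : s (h *: (1 : K) + z0) @[h --> (0 : K)^'] --> s z0.
  apply: cvg_comp (principal_root_continuous z0_gt0).
  rewrite -{2}[z0]add0r; apply: cvgD; last exact: cvg_cst.
  rewrite -[X in _ --> X](scale0r (1 : K)); apply: cvgZr_tmp.
  exact: nbhs_dnbhs.
have sum_neq0 z : s z + s z0 != 0.
  by apply: Re_gt0_neq0; rewrite raddfD/= ltr_wpDl.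
(* the difference quotient is the inverse of s(z0 + h) + s(z0) *)
have -> : 2^-1 * (s z0)^-1 = (s z0 + s z0)^-1 :> K.
  by rewrite -invfM mulr_natl mulr2n.
have /(cvgV (sum_neq0 z0)) :
  (s (h *: (1 : K) + z0) + s z0) @[h --> (0 : K)^'] --> s z0 + s z0.
  by apply: cvgD => //; exact: cvg_cst.
apply: cvg_trans; apply: near_eq_cvg; near=> h.
have hN0 : h != 0 by near: h; exact: nbhs_dnbhs_neq.
apply: (mulfI hN0); rewrite /= /GRing.scale/= mulrA divff// mul1r mulr1.
have {1}-> : h = (s (h + z0) - s z0) * (s (h + z0) + s z0).
  by rewrite -subr_sqr !sK addrK.
by rewrite mulfK.
Unshelve. all: by end_near. Qed.

Lemma is_derive_inv_root z0 : 0 < 'Re (s z0) ->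
  is_derive z0 1 (fun z => (s z)^-1 : K^o) (- 2^-1 * (s z0)^-1 ^+ 3).
Proof.
move=> z0_gt0; have dr := is_derive_root z0_gt0.
have sN0 := Re_gt0_neq0 z0_gt0.
apply: DeriveDef; first exact: derivableV.
rewrite deriveV// derive_val/= /GRing.scale/=.
by field.
Qed.

Lemma euler_derive1n (f : K -> K^o) (al : K) :
  (forall z, 0 < 'Re (s z) -> is_derive z 1 f (al * f z * (s z)^-1 ^+ 2)) ->
  forall k z, 0 < 'Re (s z) ->
    derive1n k f z = \prod_(i < k) (al - i%:R) * f z / z ^+ k /\
    derivable (derive1n k f) z 1.
Proof.
move=> df k z z_gt0.
have [-> ?] := derive1n_power near_slit df is_derive_inv_root k z_gt0.
by split => //; rewrite exprM exprVn sP.1 exprVn.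
Qed.

End PrincipalRoot.

(** * Hermite interpolation *)

Section Hermite.
Variable K : numFieldType.
Implicit Types (p q v : {poly K}) (a : K).

(** If v = u ('X - a)^i, then v' is u times i ('X - a)^(i - 1) up to a multiple of
    ('X - a)^i; as i is invertible, 'X - a divides u. *)
Lemma dvd_XsubCX_deriv a v i : (0 < i)%N ->
  ('X - a%:P) ^+ i %| v -> ('X - a%:P) ^+ i %| v^`() -> ('X - a%:P) ^+ i.+1 %| v.
Proof.
case: i => // i _ /dvdpP[u ->].
rewrite derivM deriv_exp derivXsubC mul1r (dvdp_addr _ (dvdp_mull _ (dvdpp _)))/=.
move=> dv.
rewrite exprS dvdp_mul2r ?expf_neq0 ?polyXsubC_eq0// dvdp_XsubCl.
move: dv; rewrite mulrnAr -mulrnAl exprS dvdp_mul2r ?expf_neq0 ?polyXsubC_eq0//.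
by rewrite dvdp_XsubCl !rootE hornerMn mulrn_eq0.
Qed.

Lemma dvd_XsubCX_root a v m :
  (('X - a%:P) ^+ m.+1 %| v) = root v a && (('X - a%:P) ^+ m %| v^`()).
Proof.
apply/idP/andP => [/dvdpP[u ->]|[rv]].
  rewrite exprSr mulrA rootM root_XsubC eqxx orbT; split => //.
  rewrite derivM derivXsubC mulr1; apply: dvdp_add; last exact: dvdp_mull.
  rewrite derivM mulrDl; apply: dvdp_add; first by rewrite dvdp_mulr ?dvdp_mull.
  rewrite deriv_exp derivXsubC mul1r -mulrA dvdp_mull//.
  by case: (m) => [|k]; rewrite ?dvd1p// mulrnAl -exprSr -mulr_natr dvdp_mulr.
elim: m => [|m IH] dv; first by rewrite expr1 dvdp_XsubCl.
apply: dvd_XsubCX_deriv => //; apply: IH.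
by apply: dvdp_trans dv; rewrite exprS dvdp_mull.
Qed.

Lemma dvd_XsubCX_derivn a v m :
  reflect (forall k, (k < m)%N -> v^`(k).[a] = 0) (('X - a%:P) ^+ m %| v).
Proof.
elim: m v => [|m IH] v; first by rewrite expr0 dvd1p; constructor.
rewrite dvd_XsubCX_root; apply: (iffP andP) => [[rv /IH dv] [|k] km|dv].
- by rewrite derivn0; apply/eqP.
- by rewrite derivSn; apply: dv.
split; first by rewrite rootE -[v]derivn0 dv.
by apply/IH => k km; rewrite -derivSn dv.
Qed.

(** One condition is met at a time: the product of the powers of the other
    'X - b by ('X - a)^j keeps every condition already met, while its j-th
    derivative at a is nonzero. *)
Lemma hermite_interpolation (s : seq K) (m : K -> nat) (d : K -> nat -> K) :
  uniq s ->
  exists q, forall a, a \in s -> forall k, (k < m a)%N -> q^`(k).[a] = d a k.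
Proof.
elim: s => [|a s IH] /=; first by exists 0.
case/andP=> aNs /IH[q0 q0P]; pose P := \prod_(b <- s) ('X - b%:P) ^+ m b.
suff [q qs qa] : exists2 q, (forall b, b \in s -> forall k, (k < m b)%N ->
    q^`(k).[b] = d b k) & (forall k, (k < m a)%N -> q^`(k).[a] = d a k).
  by exists q => b; rewrite inE => /predU1P[->|]; [exact: qa|exact: qs].
elim: (m a) => [|j [q qs qa]]; first by exists q0.
pose Q := P * ('X - a%:P) ^+ j.
have QN0 : Q^`(j).[a] != 0.
  apply/negP => /eqP Qj; have : ('X - a%:P) ^+ j.+1 %| Q.
    apply/dvd_XsubCX_derivn => k; rewrite ltnS leq_eqVlt => /predU1P[->//|kj].
    by have /dvd_XsubCX_derivn/(_ k kj) : ('X - a%:P) ^+ j %| Q by rewrite dvdp_mull.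
  rewrite exprS dvdp_mul2r ?expf_neq0 ?polyXsubC_eq0// dvdp_XsubCl /P.
  rewrite rootE horner_prod prodf_seq_eq0 => /hasP[b bs] /=.
  rewrite horner_exp hornerXsubC expf_eq0 subr_eq0 => /andP[_ /eqP ab].
  by rewrite ab bs in aNs.
exists (q + ((d a j - q^`(j).[a]) / Q^`(j).[a]) *: Q) => [b bs k kb|k].
  have /dvd_XsubCX_derivn/(_ k kb) Qb : ('X - b%:P) ^+ m b %| Q.
    by rewrite dvdp_mulr// /P (big_rem b)//= dvdp_mulr.
  by rewrite derivnD derivnZ hornerD hornerZ Qb mulr0 addr0 qs.
rewrite derivnD derivnZ hornerD hornerZ ltnS leq_eqVlt => /predU1P[->|kj].
  by rewrite divfK// addrC subrK.
have /dvd_XsubCX_derivn/(_ k kj) -> : ('X - a%:P) ^+ j %| Q by rewrite dvdp_mull.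
by rewrite mulr0 addr0 qa.
Qed.

(** If v vanishes to the exact order i > 0 at a, then 'X v' vanishes to the exact order
    i - 1, because a is nonzero, and then so does 'X v' - be v. *)
Lemma dvd_XsubCX_euler a v (be : K) m : a != 0 -> root v a ->
  ('X - a%:P) ^+ m.-1 %| 'X * v^`() - be *: v -> ('X - a%:P) ^+ m %| v.
Proof.
move=> a0 rv; case: m => [|m] /= dv; first by rewrite dvd1p.
elim: m dv => [|m IH] dv; first by rewrite expr1 dvdp_XsubCl.
have {}IH : ('X - a%:P) ^+ m.+1 %| v.
  by apply: IH; apply: dvdp_trans dv; rewrite exprS dvdp_mull.
apply: dvd_XsubCX_deriv => //; move: dv.
rewrite dvdp_addl; last by rewrite -scaleNr -mul_polyC dvdp_mull.
rewrite Gauss_dvdpr// coprimep_expl// -[X in coprimep _ X]subr0 -polyC0.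
by rewrite coprimep_XsubC2// sub0r oppr_eq0.
Qed.

Lemma derivn_euler q (al : K) k :
  ('X * q^`() - al *: q)^`(k) = 'X * q^`(k.+1) + (k%:R - al) *: q^`(k).
Proof.
elim: k => [|k IH]; first by rewrite !derivn0 derivn1 sub0r scaleNr.
rewrite derivnS IH derivD derivM derivX mul1r derivZ -!derivnS.
rewrite addrAC addrC; congr (_ + _).
by rewrite -[in RHS]natr1 [in RHS]addrAC [RHS]scalerDl scale1r addrC.
Qed.

End Hermite.

(** Otherwise the cofactor of the gcd of p and v in p has a root a, and the power of
    'X - a that divides the gcd is too small. *)
Lemma dvdp_closed (K : closedFieldType) (p v : {poly K}) : p != 0 ->
  (forall a, root p a -> ('X - a%:P) ^+ mup a p %| v) -> p %| v.
Proof.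
move=> pN0 pv; have gp := dvdp_gcdl p v.
have /dvdpP[h ph] := gp.
have hN0 : h != 0 by apply: contraNneq pN0 => h0; rewrite ph h0 mul0r.
have gN0 : gcdp p v != 0 by rewrite gcdp_eq0 negb_and pN0.
have [sh|] := boolP (size h == 1%N).
  have /size_poly1P[c c0 hc] := sh.
  by rewrite ph hc mul_polyC dvdpZl// dvdp_gcdr.
move=> /closed_rootP[a ra].
have rp : root p a by rewrite ph rootM ra.
have : (mup a p <= mup a (gcdp p v))%N.
  by rewrite mup_geq// dvdp_gcd pv// -mup_geq// leqnn.
rewrite {1}ph mupM// -[X in (_ <= X)%N]add0n leq_add2r leqn0.
by rewrite -leqn0 leqNgt -XsubC_dvd// dvdp_XsubCl ra.
Qed.

(** * The primary square root of a matrix and its inverse *)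

Section MatrixRoot.
Variable K : numClosedFieldType.
Variable s : K -> K.
Hypothesis sP : principal_root s.
Local Notation isqrt := (fun z => (s z)^-1).

(** This includes the default value 0, so that the consequences below hold for every
    f. *)
Lemma matfun_horner (f : K -> K^o) N (M : 'M[K]_N.+1) :
  exists q, matfun f M = horner_mx M q.
Proof.
rewrite /matfun; case: xgetP => [X _ [q _ ->]|_]; first by exists q.
by exists 0; rewrite raddf0.
Qed.

Lemma matfun_comm (f : K -> K^o) N (M Z : 'M[K]_N) :
  M *m Z = Z *m M -> matfun f M *m Z = Z *m matfun f M.
Proof.
case: N M Z => [|N] M Z MZ; first by rewrite [LHS]flatmx0 [RHS]flatmx0.
by have [q ->] := matfun_horner f M; apply: comm_horner_mx.
Qed.

Lemma trmx_horner N (M : 'M[K]_N.+1) (q : {poly K}) :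
  (horner_mx M q)^T = horner_mx M^T q.
Proof.
elim/poly_ind: q => [|q c IH]; first by rewrite !raddf0.
rewrite !raddfD /= !horner_mx_C tr_scalar_mx !rmorphM /= !horner_mx_X.
rewrite -!mulmxE trmx_mul IH; congr (_ + _).
by rewrite -{1}[M^T]horner_mx_X !mulmxE -rmorphM mulrC rmorphM /= horner_mx_X.
Qed.

Lemma matfun_sym (f : K -> K^o) N (M : 'M[K]_N) :
  M^T = M -> (matfun f M)^T = matfun f M.
Proof.
case: N M => [|N] M MT; first by rewrite [LHS]flatmx0 [RHS]flatmx0.
by have [q ->] := matfun_horner f M; rewrite trmx_horner MT.
Qed.

(** The Hermite data of f on the spectrum are those of z^al, whose k-th derivatives
    satisfy a f^(k+1)(a) = (al - k) f^(k)(a); these are the vanishing conditions at a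
    of the derivatives of 'X q' - al q. *)
Lemma matfun_euler (f : K -> K^o) (al : K) N (M : 'M[K]_N.+1) :
  (forall z, 0 < 'Re (s z) -> is_derive z 1 f (al * f z * (s z)^-1 ^+ 2)) ->
  (forall a, eigenvalue M a -> 0 < 'Re (s a)) ->
  exists2 q, matfun f M = horner_mx M q &
    forall a, root (mxminpoly M) a -> q.[a] = f a /\
      ('X - a%:P) ^+ (mup a (mxminpoly M)).-1 %| 'X * q^`() - al *: q.
Proof.
move=> df specM; set P := mxminpoly M.
have PN0 : P != 0 by rewrite monic_neq0 ?mxminpoly_monic.
have specP a : root P a -> 0 < 'Re (s a).
  by rewrite -eigenvalue_root_min; exact: specM.
have mup_gt0 a : root P a -> (0 < mup a P)%N.
  by move=> ra; rewrite -XsubC_dvd// dvdp_XsubCl.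
have [X [q qP Xq]] : exists X, is_matfun f M X.
  have [r Pr] := closed_field_poly_normal P.
  have rP a : root P a -> a \in undup r.
    by rewrite Pr rootZ ?lead_coef_eq0// root_prod_XsubC mem_undup.
  have [q qP] := hermite_interpolation (fun a => mup a P)
     (fun a k => derive1n k f a) (undup_uniq r).
  exists (horner_mx M q), q => // a; rewrite eigenvalue_root_min => ra.
  split => k km; last exact: (qP _ (rP _ ra)).
  near=> z; have z_gt0 : 0 < 'Re (s z) by near: z; exact: near_slit (specP _ ra).
  exact: (euler_derive1n sP df k z_gt0).2.
rewrite /matfun; case: xgetP => [Y _ [r {}qP ->]|/(_ X)]; last by case; exists q.
exists r => // a ra; have a_gt0 := specP _ ra.
have := qP a; rewrite eigenvalue_root_min => /(_ ra)[_ {}qP].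
split; first by have := qP 0%N (mup_gt0 _ ra); rewrite derivn0 derive1n0.
apply/dvd_XsubCX_derivn => k km.
have km1 : (k.+1 < mup a P)%N by move: km; rewrite ltn_predRL.
rewrite derivn_euler hornerD hornerZ hornerM hornerX !qP ?(ltnW km1)//.
rewrite !(euler_derive1n sP df _ a_gt0).1 big_ord_recr/=.
have a0 : a != 0 by rewrite -(sP.1 a) expf_neq0// Re_gt0_neq0.
rewrite exprS invfM.
by field; rewrite a0 expf_neq0.
Unshelve. all: by end_near. Qed.

Section Spectrum.
Variables (N : nat) (M : 'M[K]_N.+1).
Hypothesis specM : forall a, eigenvalue M a -> 0 < 'Re (s a).

(** s and its inverse are the powers 1/2 and - 1/2, so that, at each eigenvalue, q^2 and
    q r solve the Euler equations of the powers 1 and 0, which 'X and 1 also solve. *)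
Lemma matfun_root_spec : exists q r : {poly K},
  [/\ matfun (s : K -> K^o) M = horner_mx M q,
      matfun (isqrt : K -> K^o) M = horner_mx M r,
      forall a, root (mxminpoly M) a -> q.[a] = s a,
      mxminpoly M %| q ^+ 2 - 'X & mxminpoly M %| q * r - 1].
Proof.
set P := mxminpoly M.
have PN0 : P != 0 by rewrite monic_neq0 ?mxminpoly_monic.
have rootP a : root P a -> s a != 0 /\ a != 0.
  rewrite -eigenvalue_root_min => /specM/Re_gt0_neq0 sa; split => //.
  by rewrite -(sP.1 a) expf_neq0.
have [|q qE qP] := @matfun_euler s 2^-1 _ M _ specM.
  move=> z z_gt0; apply: is_derive_eq (is_derive_root sP z_gt0) _.
  by field; rewrite Re_gt0_neq0.
have [|r rE rP] := @matfun_euler isqrt (- 2^-1) _ M _ specM.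
  move=> z z_gt0; apply: is_derive_eq (is_derive_inv_root sP z_gt0) _.
  by rewrite exprS mulrA.
exists q, r; split => //; first by move=> a /qP[].
  apply: dvdp_closed => // a ra; have [sa a0] := rootP a ra.
  have [qa qeu] := qP a ra.
  apply: (@dvd_XsubCX_euler _ _ _ 1) => //.
    by rewrite rootE hornerD hornerN hornerX horner_exp qa sP.1 subrr.
  suff -> : 'X * (q ^+ 2 - 'X)^`() - 1 *: (q ^+ 2 - 'X) =
      (2 * q) * ('X * q^`() - 2^-1 *: q).
    exact: dvdp_mull.
  rewrite scale1r derivB derivX expr2 derivM [RHS]mulrBr -scalerAr scalerAl.
  rewrite mulr_natl -scaler_nat scalerA mulVf ?pnatr_eq0// scale1r scaler_nat.
  by ring.
apply: dvdp_closed => // a ra; have [sa a0] := rootP a ra.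
have [qa qeu] := qP a ra; have [ra' reu] := rP a ra.
apply: (@dvd_XsubCX_euler _ _ _ 0) => //.
  by rewrite rootE hornerD hornerN hornerM hornerC qa ra' divff// subrr.
suff -> : 'X * (q * r - 1)^`() - 0 *: (q * r - 1) =
    r * ('X * q^`() - 2^-1 *: q) + q * ('X * r^`() - (- 2^-1) *: r).
  by rewrite dvdp_add ?dvdp_mull.
rewrite scale0r subr0 derivB derivC subr0 derivM !mulrBr -!scalerAr.
rewrite scaleNr opprK (mulrC r q).
by ring.
Qed.

Lemma matfun_sqrtK : matfun (s : K -> K^o) M *m matfun (s : K -> K^o) M = M.
Proof.
have [q [r [-> _ _ qP _]]] := matfun_root_spec.
apply/eqP; rewrite -subr_eq0 -{3}[M]horner_mx_X mulmxE -rmorphM -rmorphB /=.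
by rewrite -expr2 -dvd_mxminpoly.
Qed.

Lemma matfun_sqrtV :
  matfun (s : K -> K^o) M *m matfun (isqrt : K -> K^o) M = 1%:M.
Proof.
have [q [r [-> -> _ _ qr]]] := matfun_root_spec.
apply/eqP; rewrite -subr_eq0 -[1%:M](rmorph1 (horner_mx M)) mulmxE -rmorphM -rmorphB /=.
by rewrite -dvd_mxminpoly.
Qed.

(** q - s(a) is divisible by 'X - a for each eigenvalue a, so that the product of
    these polynomials is divisible by the characteristic polynomial. *)
Lemma matfun_sqrt_annul r : char_poly M = \prod_(a <- r) ('X - a%:P) ->
  horner_mx (matfun (s : K -> K^o) M) (\prod_(a <- r) ('X - (s a)%:P)) = 0.
Proof.
have [q [_ [-> _ qP _ _]]] := matfun_root_spec => Mr.
rewrite rmorph_prod /=.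
have -> : \prod_(a <- r) horner_mx (horner_mx M q) ('X - (s a)%:P) =
    horner_mx M (\prod_(a <- r) (q - (s a)%:P)).
  rewrite rmorph_prod /=; apply: eq_bigr => a _.
  by rewrite !rmorphB /= horner_mx_X !horner_mx_C.
suff : char_poly M %| \prod_(a <- r) (q - (s a)%:P).
  by move=> /(dvdp_trans (mxminpoly_dvd_char M)); rewrite dvd_mxminpoly => /eqP.
rewrite Mr !big_seq; apply: (big_ind2 (fun x y => x %| y)) => //.
  by move=> *; exact: dvdp_mul.
move=> a ar; rewrite dvdp_XsubCl rootE hornerD hornerN hornerC qP ?subrr//.
by rewrite root_mxminpoly Mr root_prod_XsubC.
Qed.

End Spectrum.

(** Every eigenvalue of X is a root of the annihilating polynomial, and - z is not. *)
Lemma root_sum_unit N (X : 'M[K]_N.+1) (r : seq K) (z : K) :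
  (forall a, a \in r -> 0 < 'Re a) -> 0 < 'Re z ->
  horner_mx X (\prod_(a <- r) ('X - a%:P)) = 0 -> X + z%:M \in unitmx.
Proof.
move=> r_gt0 z_gt0 Xr; rewrite unitmxE unitfE; apply/negP => /det0P[v v0 vX].
have {}vX : v *m X = (- z) *: v.
  by apply/eqP; rewrite scaleNr -addr_eq0 -mul_mx_scalar -mulmxDr vX.
have : v *m horner_mx X (\prod_(a <- r) ('X - a%:P)) =
  (\prod_(a <- r) ('X - a%:P)).[- z] *: v.
  elim/poly_ind: (\prod_(a <- r) _) => [|q c IH].
    by rewrite raddf0 mulmx0 horner0 scale0r.
  rewrite rmorphD rmorphM /= horner_mx_X horner_mx_C mulmxDr -mulmxE mulmxA IH.
  by rewrite -scalemxAl vX scalerA hornerMXaddC mul_mx_scalar -scalerDl.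
rewrite Xr mulmx0 => /esym/eqP; rewrite scaler_eq0 (negPf v0) orbF.
rewrite horner_prod prodf_seq_eq0 => /hasP[a ar] /=.
rewrite hornerXsubC subr_eq0 => /eqP az.
by have := r_gt0 _ ar; rewrite -az raddfN/= oppr_gt0 lt_gtF.
Qed.

(** X D = - D X implies (X - a) D = - D (X + a).  Hence p(X) D is, up to sign, D times
    the product of the X + a; the former is 0 and the latter factors are
    invertible. *)
Lemma sylvester_inj N (X D : 'M[K]_N.+1) (r : seq K) :
  (forall a, a \in r -> 0 < 'Re a) ->
  horner_mx X (\prod_(a <- r) ('X - a%:P)) = 0 ->
  X *m D + D *m X = 0 -> D = 0.
Proof.
move=> r_gt0 Xr XD.
have unitX a : a \in r -> X + a%:M \in unitmx.
  by move=> ar; apply: root_sum_unit Xr => //; exact: r_gt0.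
have XDa a : (X - a%:M) *m D = - (D *m (X + a%:M)).
  rewrite mulmxBl mulmxDr mul_scalar_mx mul_mx_scalar opprD.
  by congr (_ - _); apply/eqP; rewrite -addr_eq0 XD.
have H t : {subset t <= r} ->
    horner_mx X (\prod_(a <- t) ('X - a%:P)) *m D = 0 -> D = 0.
  elim: t => [|a t IH] tr; first by rewrite big_nil rmorph1 mul1mx.
  rewrite big_cons mulrC rmorphM /= -mulmxE -mulmxA rmorphB /= horner_mx_X horner_mx_C.
  rewrite XDa mulmxN mulmxA => /eqP; rewrite oppr_eq0 => /eqP h.
  apply: IH; first by move=> b bt; apply: tr; rewrite inE bt orbT.
  by rewrite -[LHS](mulmxK (unitX a _)) ?h ?mul0mx// tr// mem_head.
by apply: (H r) => //; rewrite Xr mul0mx.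
Qed.

End MatrixRoot.

(** * Limits of matrices, of polynomials and of their roots *)

Section Limits.
Variables (K : numFieldType) (T : Type) (F : set_system T).
Context {FF : Filter F}.

(** Convergence is entrywise, so as to make sense for matrices of any size, the
    empty ones included. *)
Definition mxcvg m n (X : T -> 'M[K]_(m, n)) (X0 : 'M[K]_(m, n)) :=
  forall i j, X t i j @[t --> F] --> X0 i j.

(** The degrees may be unbounded; evaluation at matrices is continuous only under a
    bound on them, as in [mxcvg_horner]. *)
Definition polycvg (p : T -> {poly K}) (p0 : {poly K}) :=
  forall k, (p t)`_k @[t --> F] --> p0`_k.

Lemma cvg_distP (f : T -> K) (l : K) :
  f t @[t --> F] --> l <-> forall e : K, 0 < e -> \forall t \near F, `|l - f t| < e.
Proof. exact: cvgrPdist_lt. Qed.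

Lemma cvg_bigsum (I : Type) (r : seq I) (P : pred I) (f : I -> T -> K) (l : I -> K) :
  (forall i, P i -> f i t @[t --> F] --> l i) ->
  \sum_(i <- r | P i) f i t @[t --> F] --> \sum_(i <- r | P i) l i.
Proof. exact: (cvg_big add_continuous). Qed.

Lemma cvg_bigprod (I : Type) (r : seq I) (P : pred I) (f : I -> T -> K) (l : I -> K) :
  (forall i, P i -> f i t @[t --> F] --> l i) ->
  \prod_(i <- r | P i) f i t @[t --> F] --> \prod_(i <- r | P i) l i.
Proof. exact: (cvg_big mul_continuous). Qed.

Lemma mxcvg_cst m n (X : 'M[K]_(m, n)) : mxcvg (fun=> X) X.
Proof. by move=> i j; exact: cvg_cst. Qed.

Lemma mxcvgD m n (X Y : T -> 'M[K]_(m, n)) X0 Y0 :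
  mxcvg X X0 -> mxcvg Y Y0 -> mxcvg (fun t => X t + Y t) (X0 + Y0).
Proof.
move=> XX0 YY0 i j; rewrite mxE; under eq_fun do rewrite mxE.
exact: cvgD.
Qed.

Lemma mxcvgN m n (X : T -> 'M[K]_(m, n)) X0 :
  mxcvg X X0 -> mxcvg (fun t => - X t) (- X0).
Proof.
by move=> XX0 i j; rewrite mxE; under eq_fun do rewrite mxE; exact: cvgN.
Qed.

Lemma mxcvgM m n l (X : T -> 'M[K]_(m, n)) (Y : T -> 'M[K]_(n, l)) X0 Y0 :
  mxcvg X X0 -> mxcvg Y Y0 -> mxcvg (fun t => X t *m Y t) (X0 *m Y0).
Proof.
move=> XX0 YY0 i j; rewrite mxE; under eq_fun do rewrite mxE.
by apply: cvg_bigsum => k _; exact: cvgM.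
Qed.

Lemma mxcvgZ m n (c : T -> K) (c0 : K) (X : T -> 'M[K]_(m, n)) X0 :
  c t @[t --> F] --> c0 -> mxcvg X X0 -> mxcvg (fun t => c t *: X t) (c0 *: X0).
Proof.
by move=> cc0 XX0 i j; rewrite mxE; under eq_fun do rewrite mxE; exact: cvgM.
Qed.

Lemma mxcvg_tr m n (X : T -> 'M[K]_(m, n)) X0 :
  mxcvg X X0 -> mxcvg (fun t => (X t)^T) X0^T.
Proof. by move=> XX0 i j; rewrite mxE; under eq_fun do rewrite mxE; exact: XX0. Qed.

Lemma cvg_det n (X : T -> 'M[K]_n) X0 :
  mxcvg X X0 -> \det (X t) @[t --> F] --> \det X0.
Proof.
move=> XX0; apply: cvg_bigsum => s _; apply: cvgM; first exact: cvg_cst.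
by apply: cvg_bigprod => i _; exact: XX0.
Qed.

Lemma mxcvg_adj n (X : T -> 'M[K]_n) X0 :
  mxcvg X X0 -> mxcvg (fun t => \adj (X t)) (\adj X0).
Proof.
move=> XX0 i j; rewrite mxE; under eq_fun do rewrite mxE.
apply: cvgM; first exact: cvg_cst.
apply: cvg_det => k l; rewrite !mxE; under eq_fun do rewrite !mxE.
exact: XX0.
Qed.

Lemma near_unitmx n (X : T -> 'M[K]_n) X0 :
  mxcvg X X0 -> X0 \in unitmx -> \forall t \near F, X t \in unitmx.
Proof.
move=> XX0; rewrite unitmxE unitfE => dX0.
have /cvg_distP /(_ `|\det X0|) := cvg_det XX0; rewrite normr_gt0 => /(_ dX0).
apply: filterS => t; rewrite unitmxE unitfE.
by apply: contraTneq => ->; rewrite subr0 ltxx.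
Qed.

Lemma mxcvgV n (X : T -> 'M[K]_n) X0 :
  mxcvg X X0 -> X0 \in unitmx -> mxcvg (fun t => invmx (X t)) (invmx X0).
Proof.
move=> XX0 uX0 i j.
suff : ((\det (X t))^-1 *: \adj (X t)) i j @[t --> F] --> invmx X0 i j.
  apply: cvg_trans; apply: near_eq_cvg.
  by apply: filterS (near_unitmx XX0 uX0) => t uX; rewrite /invmx uX.
rewrite /invmx uX0; apply: mxcvgZ (mxcvg_adj XX0) i j.
by apply: cvgV (cvg_det XX0); rewrite -unitfE -unitmxE.
Qed.

Lemma polycvg_cst p : polycvg (fun=> p) p.
Proof. by move=> k; exact: cvg_cst. Qed.

Lemma polycvgD (p q : T -> {poly K}) p0 q0 :
  polycvg p p0 -> polycvg q q0 -> polycvg (fun t => p t + q t) (p0 + q0).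
Proof.
move=> pp0 qq0 k; rewrite coefD; under eq_fun do rewrite coefD.
exact: cvgD.
Qed.

Lemma polycvgM (p q : T -> {poly K}) p0 q0 :
  polycvg p p0 -> polycvg q q0 -> polycvg (fun t => p t * q t) (p0 * q0).
Proof.
move=> pp0 qq0 k; rewrite coefM; under eq_fun do rewrite coefM.
by apply: cvg_bigsum => i _; exact: cvgM.
Qed.

Lemma polycvgC (c : T -> K) (c0 : K) :
  c t @[t --> F] --> c0 -> polycvg (fun t => (c t)%:P) c0%:P.
Proof.
move=> cc0 k; rewrite coefC; under eq_fun do rewrite coefC.
by case: (k == 0)%N => //; exact: cvg_cst.
Qed.

Lemma polycvgXsubC (c : T -> K) (c0 : K) :
  c t @[t --> F] --> c0 -> polycvg (fun t => 'X - (c t)%:P) ('X - c0%:P).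
Proof.
move=> cc0; apply: polycvgD; first exact: polycvg_cst.
move=> k; rewrite coefN; under eq_fun do rewrite coefN.
by apply: cvgN; exact: polycvgC.
Qed.

Lemma polycvg_sum (I : Type) (r : seq I) (p : I -> T -> {poly K}) p0 :
  (forall i, polycvg (p i) (p0 i)) ->
  polycvg (fun t => \sum_(i <- r) p i t) (\sum_(i <- r) p0 i).
Proof.
move=> pp0 k; rewrite coef_sum; under eq_fun do rewrite coef_sum.
by apply: cvg_bigsum => i _; exact: pp0.
Qed.

Lemma polycvg_prod (I : Type) (r : seq I) (p : I -> T -> {poly K}) p0 :
  (forall i, polycvg (p i) (p0 i)) ->
  polycvg (fun t => \prod_(i <- r) p i t) (\prod_(i <- r) p0 i).
Proof.
move=> pp0; elim: r => [|i r IH].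
  by rewrite big_nil; under eq_fun do rewrite big_nil; exact: polycvg_cst.
rewrite big_cons; under eq_fun do rewrite big_cons.
exact: polycvgM.
Qed.

Lemma polycvg_char n (X : T -> 'M[K]_n) X0 :
  mxcvg X X0 -> polycvg (fun t => char_poly (X t)) (char_poly X0).
Proof.
move=> XX0; apply: polycvg_sum => s; apply: polycvgM; first exact: polycvg_cst.
apply: polycvg_prod => i; rewrite !mxE; under eq_fun do rewrite !mxE.
apply: polycvgD; first exact: polycvg_cst.
move=> k; rewrite coefN; under eq_fun do rewrite coefN.
by apply: cvgN; apply: polycvgC; exact: XX0.
Qed.

(** The bound d on the sizes makes the evaluation a sum with a fixed number of
    terms. *)
Lemma mxcvg_horner n (X : T -> 'M[K]_n.+1) X0 (p : T -> {poly K}) (p0 : {poly K}) d :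
  (forall t, size (p t) <= d)%N -> (size p0 <= d)%N ->
  mxcvg X X0 -> polycvg p p0 ->
  mxcvg (fun t => horner_mx (X t) (p t)) (horner_mx X0 p0).
Proof.
move=> sp sp0 XX0 pp0.
have E (Y : 'M[K]_n.+1) (q : {poly K}) : (size q <= d)%N ->
    horner_mx Y q = \sum_(k < d) q`_k *: Y ^+ k.
  move=> sq; rewrite -{1}(coefK q) poly_def raddf_sum /=.
  rewrite (big_ord_widen _ (fun k => horner_mx Y (q`_k *: 'X^k)) sq) big_mkcond.
  apply: eq_bigr => k _; rewrite linearZ /= rmorphXn /= horner_mx_X.
  by case: ltnP => // qk; rewrite nth_default// scale0r.
have -> : (fun t => horner_mx (X t) (p t)) =
    (fun t => \sum_(k < d) (p t)`_k *: X t ^+ k) by apply/funext => t; exact: E.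
rewrite E// => i j; rewrite summxE; under eq_fun do rewrite summxE.
apply: cvg_bigsum => k _; apply: mxcvgZ i j; first exact: pp0.
elim: (k : nat) => [|m IH]; first by rewrite expr0; exact: mxcvg_cst.
by rewrite exprS; under eq_fun do rewrite exprS; exact: mxcvgM.
Qed.

(** Synthetic division computes q from its top coefficient down by operations that
    are continuous in a. *)
Lemma polycvg_div (a : T -> K) (a0 : K) (q : T -> {poly K}) (q0 : {poly K}) d :
  (forall t, size (q t) <= d)%N -> (size q0 <= d)%N ->
  a t @[t --> F] --> a0 ->
  polycvg (fun t => ('X - (a t)%:P) * q t) (('X - a0%:P) * q0) -> polycvg q q0.
Proof.
move=> sq sq0 aa0 aq k.
have [j dk] : exists j, (d <= k + j)%N by exists d; rewrite leq_addl.
elim: j k dk => [|j IH] k.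
  rewrite addn0 => dk; rewrite nth_default ?(leq_trans sq0)//.
  under eq_fun do rewrite nth_default ?(leq_trans (sq _))//.
  exact: cvg_cst.
rewrite addnS -addSn => /IH qk1.
have E (b : K) (p : {poly K}) : p`_k = (('X - b%:P) * p)`_k.+1 + b * p`_k.+1.
  by rewrite mulrBl coefB coefXM coefCM /= subrK.
rewrite (E a0); under eq_fun => t do rewrite (E (a t)).
by apply: cvgD; [exact: aq|exact: cvgM].
Qed.

(** A root of least distance to z does it. *)
Lemma closest_root (z : K) (r : seq K) : (0 < size r)%N ->
  exists2 a, a \in r & `|z - a| ^+ size r <= `|(\prod_(b <- r) ('X - b%:P)).[z]|.
Proof.
move=> r0; have [a ar amin] : exists2 a, a \in r & {in r, forall b, `|z - a| <= `|z - b|}.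
  case: r r0 => // c r _; elim: r c => [|b r IH] c.
    by exists c; rewrite ?mem_head// => b; rewrite inE => /eqP->.
  have [a ar amin] := IH b.
  have [ca|ac] := real_leP (normr_real (z - c)) (normr_real (z - a)).
    exists c; rewrite ?mem_head// => x; rewrite inE => /predU1P[->//|/amin].
    exact: le_trans.
  exists a; first by rewrite inE ar orbT.
  by move=> x; rewrite inE => /predU1P[->|/amin//]; exact: ltW.
exists a => //; rewrite horner_prod normr_prod -iter_mulr_1 -count_predT -big_const_seq.
rewrite !big_seq; apply: ler_prod => b br; rewrite normr_ge0 hornerXsubC.
exact: amin.
Qed.

(** The polynomials tend to 0 at the root a0 of the limit, so their roots closest to
    a0 tend to a0; these are divided out, and the quotients converge by synthetic
    division. *)
Lemma roots_cvg (r : T -> seq K) (r0 : seq K) :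
  (forall t, size (r t) = size r0) ->
  polycvg (fun t => \prod_(a <- r t) ('X - a%:P)) (\prod_(a <- r0) ('X - a%:P)) ->
  exists2 r' : T -> seq K, (forall t, perm_eq (r t) (r' t)) &
    forall i, (i < size r0)%N -> (r' t)`_i @[t --> F] --> r0`_i.
Proof.
elim: r0 r => [|a0 r0 IH] r sr rr0; first by exists r.
have /choice[a aP] : forall t, exists a, a \in r t /\ `|a0 - a| ^+ (size r0).+1 <=
    `|(\prod_(b <- r t) ('X - b%:P)).[a0]|.
  move=> t; have [|a ar] := @closest_root a0 (r t); first by rewrite sr.
  by rewrite sr; exists a.
have aa0 : a t @[t --> F] --> a0.
  have : (\prod_(b <- r t) ('X - b%:P)).[a0] @[t --> F] -->
         (\prod_(b <- a0 :: r0) ('X - b%:P)).[a0].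
    have E s : size s = (size r0).+1 -> (\prod_(b <- s) ('X - b%:P)).[a0] =
        \sum_(k < (size r0).+2) (\prod_(b <- s) ('X - b%:P))`_k * a0 ^+ k.
      by move=> ss; rewrite (@horner_coef_wide _ (size r0).+2)// size_prod_XsubC ss.
    rewrite E//; under eq_fun do rewrite E ?sr//.
    by apply: cvg_bigsum => k _; apply: cvgM (rr0 k) _; exact: cvg_cst.
  move=> /cvg_distP H; apply/cvg_distP => e e0.
  have := H _ (exprn_gt0 (size r0).+1 e0); apply: filterS => t.
  rewrite horner_prod big_cons hornerXsubC subrr mul0r sub0r normrN => lt_e.
  have := le_lt_trans (aP t).2 lt_e.
  by rewrite ltr_pXn2r ?nnegrE ?normr_ge0 ?ltW.
have [||r' pr' r'cvg] := IH (fun t => rem (a t) (r t)).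
- by move=> t; rewrite size_rem ?(aP t).1// sr.
- apply: (@polycvg_div a a0 _ _ (size r0).+1) => //.
  + by move=> t; rewrite size_prod_XsubC size_rem ?(aP t).1// sr.
  + by rewrite size_prod_XsubC.
  + move: rr0; rewrite big_cons; congr (polycvg _ _); apply/funext => t.
    by rewrite (big_rem (a t) (aP t).1).
exists (fun t => a t :: r' t).
  by move=> t; rewrite (permPl (perm_to_rem (aP t).1)) perm_cons.
by case=> [|i] //= /r'cvg.
Qed.

End Limits.

Section RootContinuity.
Variable K : numClosedFieldType.
Variable s : K -> K.
Hypothesis sP : principal_root s.

(** p(- X) is, up to sign, the product of the X + a over the roots a of p. *)
Lemma annul_opp_unitmx N (X : 'M[K]_N.+1) (r : seq K) :
  (forall a, a \in r -> 0 < 'Re a) ->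
  horner_mx X (\prod_(a <- r) ('X - a%:P)) = 0 ->
  horner_mx (- X) (\prod_(a <- r) ('X - a%:P)) \in unitmx.
Proof.
move=> r_gt0 Xr; rewrite rmorph_prod /=.
suff : forall t, {subset t <= r} ->
   \prod_(a <- t) horner_mx (- X) ('X - a%:P) \in unitmx by apply.
elim=> [|a t IH] tr; first by rewrite big_nil unitmx1.
have ar : a \in r by rewrite tr ?mem_head.
rewrite big_cons -mulmxE unitmx_mul IH ?andbT; last first.
  by move=> b bt; rewrite tr// inE bt orbT.
rewrite rmorphB /= horner_mx_X horner_mx_C -opprD -scaleN1r unitmxZ ?unitrN1//.
by apply: root_sum_unit Xr => //; exact: r_gt0.
Qed.

Lemma horner_mx_comp_sqr N (X : 'M[K]_N.+1) (q : {poly K}) :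
  horner_mx X (q \Po 'X^2) = horner_mx (X * X) q.
Proof.
elim/poly_ind: q => [|q c IH]; first by rewrite comp_poly0 !raddf0.
rewrite comp_polyD comp_polyM comp_polyX comp_polyC !rmorphD !rmorphM /= IH.
by rewrite !horner_mx_C !horner_mx_X.
Qed.

(** p(Y) = E + O Y for both square roots Y = X and Y = - X of M.  The value at X is 0, so
    E = - O X; the value at - X is then - 2 O X, and it is invertible. *)
Lemma root_eq_even_odd N (X M : 'M[K]_N.+1) (r : seq K) :
  (forall a, a \in r -> 0 < 'Re a) ->
  let p := \prod_(a <- r) ('X - a%:P) in
  X * X = M -> horner_mx X p = 0 ->
  horner_mx M (odd_poly p) \in unitmx /\
  X = - (horner_mx M (even_poly p) *m invmx (horner_mx M (odd_poly p))).
Proof.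
move=> r_gt0 p XX Xp; set E := horner_mx M (even_poly p).
set O := horner_mx M (odd_poly p).
have hp Y : Y * Y = M -> horner_mx Y p = E + O * Y.
  move=> YY; rewrite -[in LHS](poly_even_odd p) rmorphD rmorphM /=.
  by rewrite !horner_mx_comp_sqr YY horner_mx_X.
have EO : E = - (O * X) by apply/eqP; rewrite -addr_eq0 -hp// Xp.
have OX : O * X = X * O by rewrite /O -XX -horner_mx_comp_sqr; exact/comm_horner_mx.
have uO : O \in unitmx.
  have := annul_opp_unitmx r_gt0 Xp; rewrite hp ?mulrNN// mulrN EO -opprD.
  by rewrite -mulr2n -scaler_nat -scaleNr unitmxZ ?unitfE ?oppr_eq0 ?pnatr_eq0//
    -mulmxE unitmx_mul => /andP[].
by split => //; rewrite EO mulNmx opprK OX -mulmxE mulmxK.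
Qed.

Variables (T : Type) (F : set_system T).
Context {FF : Filter F}.

(** The convergence of the eigenvalues of M, with their multiplicities, gives both
    conclusions: their roots stay in the right half-plane, and the coefficients in
    the formula of [root_eq_even_odd] converge. *)
Lemma matfun_root_cvg N (M : T -> 'M[K]_N.+1) (M0 : 'M[K]_N.+1) :
  mxcvg F M M0 -> (forall a, eigenvalue M0 a -> 0 < 'Re (s a)) ->
  (\forall t \near F, forall a, eigenvalue (M t) a -> 0 < 'Re (s a)) /\
  mxcvg F (fun t => matfun (s : K -> K^o) (M t)) (matfun (s : K -> K^o) M0).
Proof.
move=> MM0 spec0.
have split_char (A : 'M[K]_N.+1) : exists r, char_poly A = \prod_(a <- r) ('X - a%:P).
  have [r ->] := closed_field_poly_normal (char_poly A).
  by exists r; rewrite (monicP (char_poly_monic A)) scale1r.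
have size_r (A : 'M[K]_N.+1) (r : seq K) : char_poly A = \prod_(a <- r) ('X - a%:P) ->
    size r = N.+1.
  by move=> Ar; have := size_char_poly A; rewrite Ar size_prod_XsubC => -[->].
have [r0 r0P] := split_char M0.
have /choice[rt rP] := fun t => split_char (M t).
have [||r' pr r'cvg] := @roots_cvg K T F _ rt r0.
- by move=> t; rewrite (size_r _ _ (rP t)) (size_r _ _ r0P).
- move=> k; rewrite -r0P; under eq_fun do rewrite -rP.
  exact: polycvg_char.
have {pr} r'P t : char_poly (M t) = \prod_(a <- r' t) ('X - a%:P).
  by rewrite rP; exact: perm_big.
rewrite (size_r _ _ r0P) in r'cvg.
have r0_gt0 a : a \in r0 -> 0 < 'Re (s a).
  by move=> ar; apply: spec0; rewrite eigenvalue_root_char r0P root_prod_XsubC.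
have r0i_gt0 (i : 'I_N.+1) : 0 < 'Re (s r0`_i).
  by apply/r0_gt0/mem_nth; rewrite (size_r _ _ r0P).
have near_r' : \forall t \near F, forall i : 'I_N.+1, 0 < 'Re (s (r' t)`_i).
  apply: filter_forall => i; exact: (r'cvg i (ltn_ord i) _ (near_slit sP (r0i_gt0 i))).
have near_mem : \forall t \near F, forall a, a \in r' t -> 0 < 'Re (s a).
  apply: filterS near_r' => t r'_gt0 a /(nthP 0)[i ir <-].
  by rewrite (size_r _ _ (r'P t)) in ir; exact: (r'_gt0 (Ordinal ir)).
have near_spec : \forall t \near F, forall a, eigenvalue (M t) a -> 0 < 'Re (s a).
  apply: filterS near_mem => t r'_gt0 a.
  by rewrite eigenvalue_root_char r'P root_prod_XsubC => /r'_gt0.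
split => //.
pose p (u : seq K) := \prod_(a <- map s u) ('X - a%:P).
have pE A u : (forall a, eigenvalue A a -> 0 < 'Re (s a)) ->
    char_poly A = \prod_(a <- u) ('X - a%:P) ->
    horner_mx A (odd_poly (p u)) \in unitmx /\
    matfun (s : K -> K^o) A =
      - (horner_mx A (even_poly (p u)) *m invmx (horner_mx A (odd_poly (p u)))).
  move=> specA Au; apply: root_eq_even_odd; last 2 first.
  - exact: matfun_sqrtK.
  - by rewrite /p big_map; exact: matfun_sqrt_annul.
  move=> _ /mapP[a au ->]; apply: specA.
  by rewrite eigenvalue_root_char Au root_prod_XsubC.
have pcvg : polycvg F (fun t => p (r' t)) (p r0).
  have pN u : size u = N.+1 -> p u = \prod_(i < N.+1) ('X - (s u`_i)%:P).
    by move=> su; rewrite /p big_map (big_nth 0) su big_mkord.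
  rewrite pN ?(size_r _ _ r0P)// => k.
  under eq_fun => t do rewrite pN ?(size_r _ _ (r'P t))//.
  move: k; apply: polycvg_prod => i; apply: polycvgXsubC.
  apply: (cvg_comp _ _ (r'cvg i (ltn_ord i))).
  exact: principal_root_continuous.
have sz u : size u = N.+1 -> size (p u) = N.+2.
  by move=> su; rewrite size_prod_XsubC size_map su.
have [uO0 ->] := pE _ _ _ spec0 r0P => i j.
suff : (- (horner_mx (M t) (even_poly (p (r' t))) *m
      invmx (horner_mx (M t) (odd_poly (p (r' t)))))) i j @[t --> F] -->
   (- (horner_mx M0 (even_poly (p r0)) *m
      invmx (horner_mx M0 (odd_poly (p r0))))) i j.
  apply: cvg_trans; apply: near_eq_cvg.
  by apply: filterS near_spec => t specM; rewrite (pE _ _ _ specM (r'P t)).2.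
move: i j; apply: mxcvgN; apply: mxcvgM; last apply: mxcvgV => //.
- apply: (@mxcvg_horner _ _ _ _ _ _ _ _ _ (uphalf N.+2)) => //.
  + by move=> t; rewrite -(sz (r' t)) ?(size_r _ _ (r'P t)) ?size_even_poly.
  + by rewrite -(sz r0) ?(size_r _ _ r0P) ?size_even_poly.
  + move=> k; rewrite coef_even_poly; under eq_fun do rewrite coef_even_poly.
    exact: pcvg.
- apply: (@mxcvg_horner _ _ _ _ _ _ _ _ _ N.+2./2) => //.
  + by move=> t; rewrite -(sz (r' t)) ?(size_r _ _ (r'P t)) ?size_odd_poly.
  + by rewrite -(sz r0) ?(size_r _ _ r0P) ?size_odd_poly.
  + move=> k; rewrite coef_odd_poly; under eq_fun do rewrite coef_odd_poly.
    exact: pcvg.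
Qed.

End RootContinuity.

(** * The trace of the square root *)

Section SumNorm.
Variable K : numFieldType.

(** A submultiplicative norm that exists in all sizes and over any
    [numFieldType]. *)
Definition mxnorm1 m n (X : 'M[K]_(m, n)) : K := \sum_i \sum_j `|X i j|.

Lemma mxnorm1_ge0 m n (X : 'M[K]_(m, n)) : 0 <= mxnorm1 X.
Proof. by apply: sumr_ge0 => i _; apply: sumr_ge0. Qed.

Lemma mxnorm1_entry m n (X : 'M[K]_(m, n)) i j : `|X i j| <= mxnorm1 X.
Proof.
rewrite /mxnorm1 (bigD1 i)//= (bigD1 j)//= -addrA lerDl addr_ge0//.
  exact: sumr_ge0.
by apply: sumr_ge0 => k _; apply: sumr_ge0.
Qed.

Lemma mxnorm1_le m n (X : 'M[K]_(m, n)) c :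
  (forall i j, `|X i j| <= c) -> mxnorm1 X <= (m * n)%:R * c.
Proof.
move=> Xc; rewrite mulr_natl mulnC mulrnA -[X in _ *+ X]card_ord -sumr_const.
apply: ler_sum => i _; rewrite -[X in _ *+ X]card_ord -sumr_const.
by apply: ler_sum => j _.
Qed.

Lemma mxnorm1D m n (X Y : 'M[K]_(m, n)) : mxnorm1 (X + Y) <= mxnorm1 X + mxnorm1 Y.
Proof.
rewrite /mxnorm1 -big_split/=; apply: ler_sum => i _.
rewrite -big_split/=; apply: ler_sum => j _; rewrite mxE; exact: ler_normD.
Qed.

Lemma mxnorm1N m n (X : 'M[K]_(m, n)) : mxnorm1 (- X) = mxnorm1 X.
Proof.
by apply: eq_bigr => i _; apply: eq_bigr => j _; rewrite mxE normrN.
Qed.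

Lemma mxnorm1_tr m n (X : 'M[K]_(m, n)) : mxnorm1 X^T = mxnorm1 X.
Proof.
rewrite /mxnorm1 exchange_big/=.
by apply: eq_bigr => i _; apply: eq_bigr => j _; rewrite mxE.
Qed.

Lemma mxnorm1M m n l (X : 'M[K]_(m, n)) (Y : 'M[K]_(n, l)) :
  mxnorm1 (X *m Y) <= mxnorm1 X * mxnorm1 Y.
Proof.
have rowY k : \sum_j `|Y k j| <= mxnorm1 Y.
  by rewrite /mxnorm1 (bigD1 k)//= lerDl; apply: sumr_ge0 => i _; apply: sumr_ge0.
rewrite /mxnorm1 mulr_suml; apply: ler_sum => i _.
apply: (@le_trans _ _ (\sum_j \sum_k `|X i k| * `|Y k j|)).
  apply: ler_sum => j _; rewrite mxE; apply: le_trans (ler_norm_sum _ _ _) _.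
  by apply: ler_sum => k _; rewrite normrM.
rewrite exchange_big/= mulr_suml; apply: ler_sum => k _.
by rewrite -mulr_sumr ler_wpM2l// rowY.
Qed.

Lemma norm_mxtrace n (X : 'M[K]_n) : `|\tr X| <= mxnorm1 X.
Proof.
apply: le_trans (ler_norm_sum _ _ _) _; apply: ler_sum => i _.
by rewrite (bigD1 i)//= lerDl; apply: sumr_ge0.
Qed.

(** An injective linear endomorphism of a finite-dimensional space has a bounded
    inverse; the inverse is read off the matrix of the Sylvester map. *)
Lemma sylvester_bound N (X : 'M[K]_N) :
  (forall D, X *m D + D *m X = 0 -> D = 0) ->
  exists2 c : K, 0 < c & forall D, mxnorm1 D <= c * mxnorm1 (X *m D + D *m X).
Proof.
move=> inj; pose S := lin_mx (mulmx X) + lin_mx (mulmxr X).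
have SE D : mxvec D *m S = mxvec (X *m D + D *m X).
  by rewrite mulmxDr !mul_vec_lin -linearD.
have uS : S \in unitmx.
  rewrite unitmxE unitfE; apply/negP => /det0P[v v0 vS].
  have : vec_mx v = 0.
    by apply: inj; apply: (can_inj mxvecK); rewrite -SE vec_mxK vS linear0.
  by move=> /(congr1 mxvec); rewrite vec_mxK linear0 => v00; rewrite v00 eqxx in v0.
pose n2 : K := (N * N)%:R.
exists (n2 * (n2 * mxnorm1 (invmx S)) + 1).
  by rewrite ltr_wpDl// !mulr_ge0 ?mxnorm1_ge0// ler0n.
move=> D; set E := X *m D + D *m X.
rewrite mulrDl mul1r ler_wpDr ?mxnorm1_ge0//.
have -> : n2 * (n2 * mxnorm1 (invmx S)) * mxnorm1 E =
  n2 * (n2 * mxnorm1 E * mxnorm1 (invmx S)) by ring.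
apply: mxnorm1_le => i j.
rewrite -mxvecE -[mxvec D](mulmxK uS) SE -/E.
apply: le_trans (mxnorm1_entry _ _ _) _; apply: le_trans (mxnorm1M _ _) _.
rewrite ler_wpM2r ?mxnorm1_ge0//.
rewrite /n2 -[X in X%:R]mul1n; apply: mxnorm1_le => {}i {}j.
rewrite ord1; case/mxvec_indexP: j => k l; rewrite mxvecE; exact: mxnorm1_entry.
Qed.

Lemma near_mxnorm1 T (F : set_system T) {FF : Filter F} m n
    (X : T -> 'M[K]_(m, n)) (e : K) :
  mxcvg F X 0 -> 0 < e -> \forall t \near F, mxnorm1 (X t) < e.
Proof.
move=> X0 e0; pose e' := e / ((m * n)%:R + 1).
have d0 : 0 < (m * n)%:R + 1 :> K by rewrite ltr_wpDl.
have e'0 : 0 < e' by rewrite divr_gt0.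
have : \forall t \near F, forall ij : 'I_m * 'I_n, `|X t ij.1 ij.2| <= e'.
  apply: filter_forall => -[i j] /=.
  have /cvg_distP/(_ e' e'0) := X0 i j; apply: filterS => t.
  by rewrite mxE sub0r normrN => /ltW.
apply: filterS => t Xt; apply: (le_lt_trans (mxnorm1_le (fun i j => Xt (i, j)))).
by rewrite /e' mulrA ltr_pdivrMr// mulrC ltr_pM2l// ltrDl.
Qed.

End SumNorm.

Section TraceRoot.
Variable K : numClosedFieldType.
Variable s : K -> K.
Hypothesis sP : principal_root s.
Local Notation sqrtmx := (matfun (s : K -> K^o)).
Local Notation invsqrtmx := (matfun ((fun z => (s z)^-1) : K -> K^o)).

Lemma root_perturbation N (X D B H : 'M[K]_N) :
  X *m X = B^T *m B -> (X + D) *m (X + D) = (B + H)^T *m (B + H) ->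
  X *m D + D *m X = B^T *m H + H^T *m B + H^T *m H - D *m D.
Proof.
move=> XX XD.
have cancel (a b c d : 'M[K]_N) : a + b + (c + d) - a = b + c + d.
  by rewrite addrAC [a + b]addrC addrK addrA.
rewrite -[LHS](addrK (D *m D)) -(cancel (X *m X) _ _ (D *m D)) -!mulmxDr -mulmxDl XD XX.
by rewrite [(B + H)^T]raddfD/= mulmxDl !mulmxDr cancel.
Qed.

(** Multiplying X D + D X by Y = X^-1 and taking the trace gives twice the trace of D;
    the two terms linear in H have the same trace because Y is symmetric. *)
Lemma trace_root_expansion N (X D Y B H : 'M[K]_N) :
  X *m Y = 1%:M -> Y^T = Y ->
  X *m X = B^T *m B -> (X + D) *m (X + D) = (B + H)^T *m (B + H) ->
  (\tr D - \tr ((B *m Y)^T *m H)) *+ 2 = \tr (Y *m H^T *m H) - \tr (Y *m D *m D).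
Proof.
move=> XY YT XX XD.
have E := root_perturbation XX XD.
have trYE : \tr (Y *m (X *m D + D *m X)) = \tr D *+ 2.
  rewrite mulmxDr mxtraceD !mulmxA (mulmx1C XY) mul1mx.
  by rewrite [\tr (_ *m X)]mxtrace_mulC mulmxA XY mul1mx -mulr2n.
have trYH : \tr (Y *m (H^T *m B)) = \tr (Y *m (B^T *m H)).
  by rewrite -mxtrace_tr !trmx_mul trmxK YT mxtrace_mulC.
rewrite mulrnBl -trYE E !mulmxDr mulmxN !raddfD raddfN/= trYH trmx_mul YT !mulmxA.
by ring.
Qed.

(** The size 0 is included because a sum of block sizes is not syntactically a
    successor. *)
Lemma trace_root_differentiable N (B : 'M[K]_N) :
  (forall a, eigenvalue (B^T *m B) a -> 0 < 'Re (s a)) ->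
  forall e : K, 0 < e -> exists2 d : K, 0 < d & forall H : 'M[K]_N,
    mxnorm1 H < d ->
    `|\tr (sqrtmx ((B + H)^T *m (B + H))) - \tr (sqrtmx (B^T *m B)) -
      \tr ((B *m invsqrtmx (B^T *m B))^T *m H)| <= e * mxnorm1 H.
Proof.
case: N B => [|N] B spec0 e e0.
  exists 1 => // H _; rewrite /mxtrace !big_ord0 !subr0 normr0.
  by rewrite mulr_ge0 ?mxnorm1_ge0 ?ltW.
set X := sqrtmx _; set Y := invsqrtmx _.
have XX : X *m X = B^T *m B by exact: matfun_sqrtK.
have XY : X *m Y = 1%:M by exact: matfun_sqrtV.
have YT : Y^T = Y by apply: matfun_sym; rewrite trmx_mul trmxK.
have [c c0 cP] : exists2 c : K, 0 < c &
    forall D, mxnorm1 D <= c * mxnorm1 (X *m D + D *m X).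
  apply: sylvester_bound => D.
  have [r Br] := closed_field_poly_normal (char_poly (B^T *m B)).
  rewrite (monicP (char_poly_monic _)) scale1r in Br.
  apply: (@sylvester_inj _ _ _ _ (map s r)).
    move=> _ /mapP[a ar ->]; apply: spec0.
    by rewrite eigenvalue_root_char Br root_prod_XsubC.
  by rewrite big_map; exact: matfun_sqrt_annul.
pose F := nbhs (0 : 'M[K]_N.+1).
have H0 : mxcvg F id (0 : 'M[K]_N.+1).
  by move=> i j; exact: coord_continuous.
have BH : mxcvg F (fun H => B + H) B.
  by rewrite -{2}[B]addr0; apply: mxcvgD => //; exact: mxcvg_cst.
have [spec Xcvg] := matfun_root_cvg sP (mxcvgM (mxcvg_tr BH) BH) spec0.
pose D H := sqrtmx ((B + H)^T *m (B + H)) - X.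
have D0 : mxcvg F D 0.
  by rewrite -(subrr X); apply: mxcvgD => //; exact: mxcvg_cst.
pose b := mxnorm1 B; pose y := mxnorm1 Y.
(* D(H) is bounded by a h, where h is the norm of H, and the remainder by q h^2 *)
pose a := 2 * c * (2 * b + 1); pose q := y * (1 + a ^+ 2) + 1.
have [b0 y0] : 0 <= b /\ 0 <= y by split; exact: mxnorm1_ge0.
have a0 : 0 <= a by rewrite !mulr_ge0 ?addr_ge0 ?mulr_ge0// ltW.
have q0 : 0 < q by rewrite ltr_wpDl// mulr_ge0// addr_ge0 ?exprn_ge0.
suff : \forall H \near F,
    `|\tr (sqrtmx ((B + H)^T *m (B + H))) - \tr X - \tr ((B *m Y)^T *m H)|
      <= e * mxnorm1 H.
  move=> /nbhs_ballP[d d0 dP]; exists d => // H Hd; apply: dP; split => // i j.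
  by rewrite /ball/= mxE sub0r normrN; exact: le_lt_trans (mxnorm1_entry _ _ _) Hd.
have c2 : 0 < (2 * c)^-1 by rewrite invr_gt0 mulr_gt0.
have eq0 : 0 < e / q by rewrite divr_gt0.
near=> H.
have specH : forall a, eigenvalue ((B + H)^T *m (B + H)) a -> 0 < 'Re (s a).
  by near: H.
have Dsmall : mxnorm1 (D H) < (2 * c)^-1 by near: H; exact: near_mxnorm1.
have H1 : mxnorm1 H < 1 by near: H; exact: (near_mxnorm1 H0).
have He : mxnorm1 H < e / q by near: H; exact: (near_mxnorm1 H0).
have h0 := mxnorm1_ge0 H; set h := mxnorm1 H in H1 He h0 *.
have XD : (X + D H) *m (X + D H) = (B + H)^T *m (B + H).
  by rewrite /D addrC subrK; exact: matfun_sqrtK.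
have key := trace_root_expansion XY YT XX XD.
have -> : \tr (sqrtmx ((B + H)^T *m (B + H))) - \tr X = \tr (D H).
  by rewrite /D raddfB.
have Dh : mxnorm1 (D H) <= a * h.
  have ED : X *m D H + D H *m X = B^T *m H + H^T *m B + H^T *m H - D H *m D H.
    exact: root_perturbation XX XD.
  have nB := mxnorm1_tr B; have nH := mxnorm1_tr H.
  have bound : mxnorm1 (X *m D H + D H *m X) <=
      (2 * b + 1) * h + mxnorm1 (D H) * mxnorm1 (D H).
    rewrite ED; apply: le_trans (mxnorm1D _ _) _; rewrite mxnorm1N.
    apply: lerD; last exact: mxnorm1M.
    rewrite [leRHS]mulrDl mul1r; apply: le_trans (mxnorm1D _ _) _; apply: lerD.
      apply: le_trans (mxnorm1D _ _) _; rewrite -mulrA mulr_natl mulr2n.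
      apply: lerD; first by rewrite /b -nB; exact: mxnorm1M.
      by rewrite mulrC /h -nH; exact: mxnorm1M.
    apply: le_trans (mxnorm1M _ _) _; rewrite nH -/h.
    by rewrite -[leRHS]mulr1 ler_wpM2l// ltW.
  have := cP (D H); set x := mxnorm1 (D H) in bound Dsmall *.
  have x0 : 0 <= x by exact: mxnorm1_ge0.
  move=> /le_trans/(_ (ler_wpM2l (ltW c0) bound)); rewrite mulrDr => cx.
  (* absorbing the quadratic term: c x < 1/2 *)
  have half : c * (x * x) <= 2^-1 * x.
    rewrite mulrA ler_wpM2r// -ler_pdivlMl// -invfM mulrC; exact: ltW.
  have x2 : x = 2 * (x - 2^-1 * x) by field.
  rewrite x2 /a -!mulrA ler_wpM2l// lerBlDr mulrA.
  by apply: le_trans cx _; rewrite mulrA lerD2l.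
have -> : \tr (D H) - \tr ((B *m Y)^T *m H) =
   2^-1 * (\tr (Y *m H^T *m H) - \tr (Y *m D H *m D H)).
  by rewrite -key -[(_ - _) *+ 2]mulr_natl mulrA mulVf ?pnatr_eq0// mul1r.
rewrite normrM ger0_norm ?invr_ge0//.
have half1 : 2^-1 <= 1 :> K by rewrite invf_le1// ler1n.
apply: le_trans (ler_wpM2r (normr_ge0 _) half1) _; rewrite mul1r.
apply: le_trans (ler_normB _ _) _.
have trip (P Q : 'M[K]_N.+1) : `|\tr (Y *m P *m Q)| <= y * (mxnorm1 P * mxnorm1 Q).
  apply: le_trans (norm_mxtrace _) _; rewrite -mulmxA; apply: le_trans (mxnorm1M _ _) _.
  by rewrite ler_wpM2l// mxnorm1M.
apply: le_trans (lerD (trip _ _) (trip _ _)) _; rewrite mxnorm1_tr -/h.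
apply: (@le_trans _ _ (q * h * h)).
  rewrite /q mulrDl mul1r mulrDl -[leLHS]addr0; apply: lerD; last by rewrite mulr_ge0.
  have -> : y * (1 + a ^+ 2) * h * h = y * (h * h) + y * ((a * h) * (a * h)) by ring.
  by rewrite lerD2l ler_wpM2l// ler_pM ?mxnorm1_ge0.
by rewrite ler_wpM2r// mulrC -ler_pdivlMr// ltW.
Unshelve. all: by end_near. Qed.


End TraceRoot.

(** * The algebra of the t-product and the gradient *)

Section TensorAlgebra.
Variable K : numClosedFieldType.
Variable p : nat.
Local Notation tens n m := (tensor K n m p.+1).

Lemma tprodE n m l (A : tens n m) (B : tens m l) k :
  tprod A B k = \sum_s A (k - s) *m B s.
Proof. by rewrite /tprod /fold ffunE mul_mxblock_mxrow mxcolK. Qed.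

Lemma bcirc_tprod n m l (A : tens n m) (B : tens m l) :
  bcirc (tprod A B) = bcirc A *m bcirc B.
Proof.
rewrite mul_mxblock; apply: eq_mxblock => i k; rewrite tprodE.
rewrite (reindex_inj (addIr (- k))) /=; apply: eq_bigr => j _.
by rewrite opprB addrA subrK.
Qed.

Lemma bcirc_ttr n m (A : tens n m) : bcirc (ttr A) = (bcirc A)^T.
Proof. by rewrite tr_mxblock; apply: eq_mxblock => i k; rewrite ffunE opprB. Qed.

Lemma bcircD n m (A B : tens n m) : bcirc (A + B) = bcirc A + bcirc B.
Proof. by rewrite -mxblockD; apply: eq_mxblock => i k; rewrite ffunE. Qed.

Lemma mxtrace_bcirc n (A : tens n n) : \tr (bcirc A) = trace1 A *+ p.+1.
Proof.
rewrite mxtrace_mxblock -[X in _ *+ X]card_ord -sumr_const; apply: eq_bigr => i _.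
by rewrite subrr.
Qed.

(** The identity slice in position d: its image under [bcirc] is a power of the
    block shift. *)
Definition tshift n (d : 'I_p.+1) : tens n n := [ffun k => (k == d)%:R%:M].

Lemma tprod_shiftr n (A : tens n n) d k : tprod A (tshift n d) k = A (k - d).
Proof.
rewrite tprodE (bigD1 d)//= big1 ?addr0 => [|i id].
  by rewrite ffunE eqxx mulmx1.
by rewrite ffunE (negPf id) raddf0 mulmx0.
Qed.

Lemma tprod_shiftl n (A : tens n n) d k : tprod (tshift n d) A k = A (k - d).
Proof.
rewrite tprodE (bigD1 (k - d))//= big1 ?addr0 => [|i id].
  by rewrite ffunE subKr eqxx mul1mx.
rewrite ffunE (_ : (_ == _) = false) ?raddf0 ?mul0mx//.
by apply: contraNF id => /eqP <-; rewrite subKr.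
Qed.

(** Commuting with the block shifts makes the block (i, d) equal to the block
    (i - d, 0); so the first block column determines F. *)
Lemma bcirc_fold n (F : 'M[K]_(\sum_(r < p.+1) n)) :
  (forall d, F *m bcirc (tshift n d) = bcirc (tshift n d) *m F) ->
  bcirc (fold (F *m E1 K p n)) = F.
Proof.
move=> Fd; rewrite -[F in LHS]submxblockK -[RHS]submxblockK.
apply: eq_mxblock => i d; rewrite /fold ffunE mul_mxblock_mxrow mxcolK.
transitivity (submxblock F (i - d) 0).
  rewrite (bigD1 0)//= big1 ?addr0 ?mulmx1// => j /negPf ->.
  by rewrite raddf0 mulmx0.
have := Fd d; rewrite -{1 2}[F]submxblockK !mul_mxblock.
move=> /(congr1 (fun X => submxblock X i 0)); rewrite !mxblockK.
rewrite (bigD1 d)//= [X in _ + X = _ -> _]big1 => [|j /negPf jd]; last first.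
  by rewrite ffunE subr0 jd raddf0 mulmx0.
rewrite (bigD1 (i - d))//= [X in _ = _ + X -> _]big1 => [|j jd]; last first.
  rewrite ffunE (_ : (_ == _) = false) ?raddf0 ?mul0mx//.
  by apply: contraNF jd => /eqP <-; rewrite subKr.
by rewrite !addr0 !ffunE subr0 subKr eqxx mulmx1 mul1mx => <-.
Qed.

Lemma bcirc_tfun n f (A : tens n n) : bcirc (tfun f A) = matfun f (bcirc A).
Proof.
apply: bcirc_fold => d; apply: matfun_comm; rewrite -!bcirc_tprod; congr bcirc.
by apply/ffunP => k; rewrite tprod_shiftr tprod_shiftl.
Qed.

Lemma trace1_ttrE n (G C : tens n n) :
  trace1 (tprod (ttr G) C) = \sum_k \tr ((G k)^T *m C k).
Proof.
rewrite /trace1 tprodE raddf_sum; apply: eq_bigr => k _.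
by rewrite ffunE sub0r opprK.
Qed.

(** Tested on the tensors with a single nonzero entry, the form reads off the
    entries of G. *)
Lemma trace1_ttr_inj n (G G' : tens n n) :
  (forall C, trace1 (tprod (ttr G) C) = trace1 (tprod (ttr G') C)) -> G = G'.
Proof.
move=> GG'; apply/ffunP => k; apply/matrixP => i j.
have E (H : tens n n) :
    trace1 (tprod (ttr H) [ffun l => if l == k then delta_mx i j else 0]) = H k i j.
  rewrite trace1_ttrE (bigD1 k)//= big1 ?addr0 => [|l /negPf lk]; last first.
    by rewrite ffunE lk mulmx0 raddf0.
  rewrite ffunE eqxx mxtrace_mulC /mxtrace (bigD1 i)//= big1 ?addr0 => [|l /negPf li].
    rewrite mxE (bigD1 j)//= big1 ?addr0 => [|l /negPf lj].
      by rewrite !mxE !eqxx mul1r.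
    by rewrite !mxE lj andbF mul0r.
  by rewrite mxE big1// => l' _; rewrite !mxE li mul0r.
by rewrite -E GG' E.
Qed.

Lemma frobenius_ge0 n m (C : tens n m) : 0 <= frobenius C.
Proof.
rewrite sqrtC_ge0; do 3![apply: sumr_ge0 => ? _]; exact: exprn_ge0.
Qed.

Lemma frobenius_entry n m (C : tens n m) k i j : `|C k i j| <= frobenius C.
Proof.
have sq0 (x : K) : 0 <= `|x| ^+ 2 by rewrite exprn_ge0.
rewrite -[leLHS]sqrCK// ler_sqrtC ?nnegrE//; last first.
  by do 3![apply: sumr_ge0 => ? _].
rewrite (bigD1 k)//= (bigD1 i)//= (bigD1 j)//= -!addrA lerDl !addr_ge0//.
- exact: sumr_ge0.
- by do 2![apply: sumr_ge0 => ? _].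
- by do 3![apply: sumr_ge0 => ? _].
Qed.

Lemma frobeniusZ n m (a : K) (C : tens n m) : frobenius (a *: C) = `|a| * frobenius C.
Proof.
rewrite /frobenius -[`|a|]sqrCK// -rootCMl ?exprn_ge0//; congr sqrtC.
rewrite mulr_sumr; apply: eq_bigr => k _; rewrite mulr_sumr; apply: eq_bigr => i _.
rewrite mulr_sumr; apply: eq_bigr => j _; by rewrite !ffunE mxE normrM exprMn.
Qed.

Lemma mxnorm1_bcirc n : exists2 c : K, 0 < c &
  forall C : tens n n, mxnorm1 (bcirc C) <= c * frobenius C.
Proof.
pose N := (\sum_(r < p.+1) n)%N.
exists ((N * N)%:R + 1) => [|C]; first by rewrite ltr_wpDl.
rewrite mulrDl mul1r ler_wpDr ?frobenius_ge0//; apply: mxnorm1_le => i j.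
by rewrite mxE; exact: frobenius_entry.
Qed.

(** The difference of two differentials is linear and o(|C|); scaling a direction C
    down to the radius where the estimates hold shows that it vanishes at C. *)
Lemma frechet_unique n (g : tens n n -> K) A L L' :
  is_frechet g A L -> is_frechet g A L' -> L =1 L'.
Proof.
move=> [linL gL] [linL' gL'] C; apply/eqP; rewrite -subr_eq0; apply/negPn/negP => DC.
pose D X := L X - L' X; have f0 := frobenius_ge0 C; set f := frobenius C in f0.
have f1 : 0 < f + 1 by rewrite ltr_wpDl.
pose e := `|D C| / (2 * (f + 1)).
have D0 : 0 < `|D C| by rewrite normr_gt0.
have e0 : 0 < e by rewrite divr_gt0// mulr_gt0.
have [d d0 dP] := gL e e0; have [d' d'0 dP'] := gL' e e0.
have [u u0 [ud ud']] : exists2 u, 0 < u & u <= d /\ u <= d'.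
  have [dd'|d'd] := real_leP (gtr0_real d0) (gtr0_real d'0).
    by exists d.
  by exists d'; rewrite // ltW.
pose t := u / (f + 1); have t0 : 0 < t by rewrite divr_gt0.
have ft : frobenius (t *: C) < u.
  rewrite frobeniusZ gtr0_norm// /t -/f -mulrA -[ltRHS]mulr1 ltr_pM2l//.
  by rewrite ltr_pdivrMl// mulr1 ltrDl.
have linE (M : tens n n -> K) : scalar M -> M (t *: C) = t * M C.
  move=> linM; have M0 : M 0 = 0.
    have := linM 1 0 0; rewrite scale1r addr0 mul1r => /eqP.
    by rewrite -subr_eq0 opprD addrA subrr sub0r oppr_eq0 => /eqP.
  by have := linM t C 0; rewrite !addr0 M0 addr0.
have H : `|t * D C| <= e * (t * f) + e * (t * f).
  have -> : t * D C = (g (A + t *: C) - g A - L' (t *: C)) -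
     (g (A + t *: C) - g A - L (t *: C)) by rewrite /D !linE//; ring.
  apply: le_trans (ler_normB _ _) _; apply: lerD.
    by apply: le_trans (dP' _ (lt_le_trans ft ud')) _; rewrite frobeniusZ gtr0_norm.
  by apply: le_trans (dP _ (lt_le_trans ft ud)) _; rewrite frobeniusZ gtr0_norm.
move: H; have -> : e * (t * f) + e * (t * f) = t * (`|D C| * (f / (f + 1))).
  by rewrite /e; field; rewrite gt_eqF.
rewrite normrM gtr0_norm// ler_pM2l// -[leLHS]mulr1 ler_pM2l//.
by rewrite ler_pdivlMr// mul1r gerDl ler10.
Qed.

Variable s : K -> K.
Hypothesis sP : principal_root s.

Lemma nuclear_frechet n (A : tens n n) :
  (forall a, eigenvalue (bcirc (tprod (ttr A) A)) a -> 0 < 'Re (s a)) ->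
  let G := tprod A (tfun (fun z => (s z)^-1) (tprod (ttr A) A)) in
  is_frechet (fun M => trace1 (tfun s (tprod (ttr M) M))) A
    (fun C => trace1 (tprod (ttr G) C)).
Proof.
move=> spec G; split.
  move=> a u v; rewrite !trace1_ttrE mulr_sumr -big_split /=; apply: eq_bigr => k _.
  by rewrite !ffunE mulmxDr -scalemxAr mxtraceD mxtraceZ.
move=> e e0; have [c c0 cP] := mxnorm1_bcirc n.
have ec0 : 0 < e / c by rewrite divr_gt0.
have := @trace_root_differentiable K s sP _ (bcirc A).
rewrite -bcirc_ttr -bcirc_tprod => /(_ spec _ ec0)[d d0 dP].
exists (d / c) => [|C Cd]; first by rewrite divr_gt0.
have bC : mxnorm1 (bcirc C) < d.
  by apply: le_lt_trans (cP C) _; rewrite mulrC -ltr_pdivlMr.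
have := dP _ bC; rewrite -bcircD -!bcirc_ttr -!bcirc_tprod -!bcirc_tfun -bcirc_tprod.
rewrite -bcirc_ttr -bcirc_tprod !mxtrace_bcirc -!mulrnBl normrMn => H.
apply: (@le_trans _ _ (e / c * mxnorm1 (bcirc C))).
  apply: le_trans H; rewrite -mulr_natl ler_peMl// ler1n//.
by rewrite -mulrA ler_wpM2l ?(ltW e0)// ler_pdivrMl.
Qed.

End TensorAlgebra.

Lemma principal_root_psqrt (R : realType) : principal_root (@psqrt R).
Proof.
split=> z; first exact: sqr_sqrtc.
rewrite -complexRe lecR /psqrt; case: z => a b /=; exact: sqrtr_ge0.
Qed.

Theorem theorem3 (R : realType) (n p : nat)
    (A : tensor R[i]%C n n p.+1)
    (hA : tisqrt_defined (tprod (ttr A) A)) :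
  frechet_differentiable (@nuclear_norm R p n) A /\
  (forall G : tensor R[i]%C n n p.+1,
     is_gradient (@nuclear_norm R p n) A G <->
     G = tprod A (tisqrt (tprod (ttr A) A))).
Proof.
have sP := principal_root_psqrt R.
have fre := @nuclear_frechet _ p _ sP n A
  (fun a ea => principal_root_slit sP (hA a ea)).
split; first by eexists; exact: fre.
move=> G; split => [[L freL LG]|->]; last by eexists; [exact: fre|].
apply: trace1_ttr_inj => C; rewrite -LG; exact: (frechet_unique freL fre).
Qed.
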